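(* Let $\alpha\in[0,1)$ and let $G$ be a connected graph of order $n\ge3$ and size $m\ge2$. Let $c=m\{\alpha^2n^3+n^2(2-4\alpha-\alpha^2)+n(4\alpha-2-2\alpha^2m)+4\alpha^2m\}$. If $s_n\ge\frac{\sqrt c}{n^3}$, then $$E(A_\alpha(G))>\frac{2n}{1+n^2}\sqrt{\left((1-\alpha)^2\,2m+\frac{\alpha^2}{2}(\Delta-\delta)^2\right)n}.$$
   Context: Graphs are finite and simple; $\delta$ and $\Delta$ are the minimum and maximum vertex degrees of $G$. For a graph $G$ with $n$ vertices and $m$ edges, adjacency matrix $A(G)$ and diagonal degree matrix $D(G)$, $A_\alpha(G)=\alpha D(G)+(1-\alpha)A(G)$ with eigenvalues $p_1,\dots,p_n$. The numbers $s_1\ge s_2\ge\dots\ge s_n\ge0$ are the values $\left|p_i-\frac{2\alpha m}{n}\right|$, $i=1,\dots,n$, arranged in non-increasing order. The $A_\alpha$-energy is $E(A_\alpha(G))=\sum_{i=1}^n\left|p_i-\frac{2\alpha m}{n}\right|=\sum_{i=1}^n s_i$. *)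

(* Defs.v *)
From HB Require Import structures.
From mathcomp Require Import all_boot all_order all_algebra.
From mathcomp Require Import polyrcf complex reals.

Set Implicit Arguments.
Unset Strict Implicit.
Unset Printing Implicit Defensive.

Import Order.TTheory GRing.Theory Num.Theory.

Local Open Scope ring_scope.

Record sgraph (n : nat) := SGraph {
  adj :> rel 'I_n;
  adj_sym : symmetric adj;
  adj_irr : irreflexive adj
}.

Definition edges (n : nat) (G : sgraph n) : {set {set 'I_n}} :=
  [set [set e.1; e.2] | e : 'I_n * 'I_n & adj G e.1 e.2].

Definition gsize (n : nat) (G : sgraph n) : nat := #|edges G|.

Definition deg (n : nat) (G : sgraph n) (v : 'I_n) : nat :=
  #|[set w | adj G v w]|.

Definition maxdeg (n : nat) (G : sgraph n) : nat := \max_(v < n) deg G v.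

(* Every degree is less than n, so when n > 0 the initial value n does not
   affect the minimum. *)
Definition mindeg (n : nat) (G : sgraph n) : nat :=
  \big[minn/n]_(v < n) deg G v.

Definition gconnected (n : nat) (G : sgraph n) : Prop :=
  forall u v : 'I_n, connect (adj G) u v.

(* The eigenvalues lying in R, each repeated according to its multiplicity as
   a root of the characteristic polynomial. For a symmetric matrix these are
   all n eigenvalues: see prod_eigenvalues and size_eigenvalues. *)
Definition eigenvalues (R : rcfType) (n : nat) (A : 'M[R]_n) : seq R :=
  flatten [seq nseq (mup x (char_poly A)) x | x <- rootsR (char_poly A)].

Lemma char_poly_sym_split (R : rcfType) (n : nat) (A : 'M[R]_n) :
  A^T = A -> exists s : seq R, char_poly A = \prod_(x <- s) ('X - x%:P).
Proof.
move=> symA; pose B := map_mx (real_complex R) A.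
have hB : B \is hermsymmx.
  apply: realsym_hermsym.
    apply/is_hermitianmxP; rewrite expr0 scale1r.
    by rewrite map_mx_id // /B map_trmx symA.
  by apply/mxOverP => i j; rewrite mxE complex_real.
have /mxOverP dreal := hermitian_spectral_diag_real hB.
have /orthomx_spectralP eqB := hermitian_normalmx hB.
set P := spectralmx B in eqB; set d := spectral_diag B in eqB dreal.
have Pu : P \in unitmx by apply: spectral_unit.
exists [seq complex.Re (d 0 i) | i <- enum 'I_n].
apply: (map_poly_inj (real_complex R)).
rewrite map_char_poly -/B rmorph_prod big_map big_enum /=.
transitivity (char_poly (diag_mx d)).
  rewrite eqB /char_poly /char_poly_mx.
  pose Q := map_mx polyC P; pose Q' := map_mx polyC (invmx P).
  have QQ' : Q' *m Q = 1%:M by rewrite -map_mxM mulVmx // map_mx1.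
  have -> : 'X%:M - map_mx polyC (invmx P *m diag_mx d *m P)
          = Q' *m ('X%:M - map_mx polyC (diag_mx d)) *m Q.
    rewrite mulmxBr mulmxBl !map_mxM; congr (_ - _).
    by rewrite mul_mx_scalar -scalemxAl QQ' scalemx1.
  by rewrite !det_mulmx mulrAC -det_mulmx QQ' det1 mul1r.
rewrite char_poly_trig ?diag_mx_is_trig //.
apply: eq_bigr => i _; rewrite rmorphB /= map_polyX map_polyC /= !mxE eqxx.
by rewrite mulr1n; have /complex_realP[x ->] := dreal 0 i.
Qed.

Lemma prod_eigenvalues (R : rcfType) (n : nat) (A : 'M[R]_n) :
  A^T = A -> char_poly A = \prod_(x <- eigenvalues A) ('X - x%:P).
Proof.
move=> /char_poly_sym_split[s eqs]; rewrite {1}eqs; apply: perm_big.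
have p0 : char_poly A != 0 by rewrite monic_neq0 ?char_poly_monic.
apply/allP => x _ /=; apply/eqP.
rewrite /eigenvalues count_flatten -map_comp.
rewrite (eq_map (g := fun y => (y == x) * mup y (char_poly A))%N); last first.
  by move=> y; rewrite /= count_nseq.
rewrite sumnE big_map -mu_prod_XsubC -eqs.
have memr : (x \in rootsR (char_poly A)) = root (char_poly A) x.
  by have := roots_on_rootsR p0 x; rewrite inE /=.
have [rx|nrx] := boolP (root (char_poly A) x); last first.
  rewrite mupNroot // big1_seq // => y /= yr.
  by case: eqP => // yx; move: memr nrx; rewrite -yx yr => <-.
rewrite (bigD1_seq x) ?memr //= ?uniq_roots // eqxx mul1n big1 ?addn0 //.
by move=> y /negPf->.
Qed.

Lemma size_eigenvalues (R : rcfType) (n : nat) (A : 'M[R]_n) :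
  A^T = A -> size (eigenvalues A) = n.
Proof.
move=> /prod_eigenvalues/(congr1 (fun p : {poly R} => size p)).
by rewrite size_char_poly size_prod_XsubC => -[].
Qed.

Definition adjmx (R : realType) (n : nat) (G : sgraph n) : 'M[R]_n :=
  \matrix_(u, v) (adj G u v)%:R.

Definition degmx (R : realType) (n : nat) (G : sgraph n) : 'M[R]_n :=
  diag_mx (\row_v (deg G v)%:R).

Definition Aalpha (R : realType) (n : nat) (alpha : R) (G : sgraph n) :
    'M[R]_n :=
  alpha *: degmx R G + (1 - alpha) *: adjmx R G.

Lemma Aalpha_sym (R : realType) (n : nat) (alpha : R) (G : sgraph n) :
  (Aalpha alpha G)^T = Aalpha alpha G.
Proof.
apply/matrixP => u v; rewrite !mxE adj_sym.
by case: (altP (u =P v)) => [->|]; rewrite ?eqxx //= eq_sym => /negPf->.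
Qed.

Definition deviations (R : realType) (n : nat) (alpha : R) (G : sgraph n) :
    seq R :=
  [seq `|p - 2 * alpha * (gsize G)%:R / n%:R| | p <- eigenvalues (Aalpha alpha G)].

(* sdev alpha G i is s_i for 1 <= i <= n: indices start at 1. *)
Definition sdev (R : realType) (n : nat) (alpha : R) (G : sgraph n)
    (i : nat) : R :=
  nth 0 (sort >=%R (deviations alpha G)) i.-1.

Definition energy (R : realType) (n : nat) (alpha : R) (G : sgraph n) : R :=
  \sum_(p <- eigenvalues (Aalpha alpha G))
    `|p - 2 * alpha * (gsize G)%:R / n%:R|.

Lemma energy_sdev (R : realType) (n : nat) (alpha : R) (G : sgraph n) :
  energy alpha G = \sum_(1 <= i < n.+1) sdev alpha G i.
Proof.
have szs : size (sort >=%R (deviations alpha G)) = n.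
  by rewrite size_sort size_map size_eigenvalues // Aalpha_sym.
have -> : energy alpha G = \sum_(x <- deviations alpha G) x by rewrite big_map.
by rewrite big_add1 -(perm_big _ (permEl (perm_sort >=%R _))) (big_nth 0) szs.
Qed.

(* Main.v *)
(* Let S be the sum of the s_i ^ 2. Traces of A_alpha and of its square give
   S = (1 - alpha)^2 2m + alpha^2 sum_v (d_v - 2m/n)^2, which is at least the
   quantity T under the root (without the factor n), since the maximum and
   minimum degree vertices alone contribute (Delta - delta)^2 / 2. As the p_i
   are centred at their mean, s_1^2 <= (n - 1) S / n, and de Caen's bound on
   the sum of the squared degrees turns this into n^2 s_1^2 <= c. The
   hypothesis on s_n therefore places all the s_i in [s_1 / n^2, s_1], where
   a Polya-Szego reverse Cauchy-Schwarz inequality bounds their sum below. *)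

Require Import Defs.
From mathcomp Require Import all_boot all_order all_algebra.
From mathcomp Require Import reals ring lra.

Import Order.TTheory GRing.Theory Num.Theory.
Local Open Scope ring_scope.

(** * Traces as power sums of eigenvalues *)

(** For n > 0 both sides are minus the coefficient of X^(n-1) in the characteristic polynomial; the
    empty matrix is treated apart. *)
Lemma mxtrace_split (R : idomainType) (n : nat) (A : 'M[R]_n) (s : seq R) :
  char_poly A = \prod_(x <- s) ('X - x%:P) -> \tr A = \sum_(x <- s) x.
Proof.
move=> eqs; have szs : size s = n.
  by move: (size_char_poly A); rewrite eqs size_prod_XsubC => -[].
case: n A eqs szs => [|n] A eqs szs.
  by rewrite (size0nil szs) big_nil /mxtrace big_ord0.
have := char_poly_trace A (ltn0Sn n).
have := @coefPn_prod_XsubC _ s; rewrite szs eqs => -> //.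
by move=> /oppr_inj ->.
Qed.

(** Substitution is a ring morphism, so it passes through the determinant. The values needed are
    those at X^2, X and -X. *)
Lemma char_poly_comp (R : comNzRingType) (n : nat) (A : 'M[R]_n)
    (q : {poly R}) :
  char_poly A \Po q = \det (q%:M - map_mx polyC A).
Proof.
rewrite /char_poly -[LHS]/(comp_poly q _) -det_map_mx; congr (\det _).
apply/matrixP => i j; rewrite !mxE rmorphB rmorphMn /= comp_polyX.
by rewrite comp_polyC.
Qed.

(* det (X^2 - A^2) = det (X - A) det (X + A), the second factor being, up to
   the sign (-1)^n, the characteristic polynomial of A at -X. *)
Lemma char_poly_sqr_split (R : idomainType) (n : nat) (A : 'M[R]_n)
    (s : seq R) :
  char_poly A = \prod_(x <- s) ('X - x%:P) ->
  char_poly (A *m A) = \prod_(x <- s) ('X - (x ^+ 2)%:P).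
Proof.
move=> eqs; have szs : size s = n.
  by move: (size_char_poly A); rewrite eqs size_prod_XsubC => -[].
(* Substituting X^2 for X is injective: the coefficient of index i moves to index 2i. *)
suff eqX2 : char_poly (A *m A) \Po 'X^2
          = (\prod_(x <- s) ('X - (x ^+ 2)%:P)) \Po 'X^2.
  apply/polyP => i; have := congr1 (fun p : {poly R} => p`_(i * 2)) eqX2.
  by rewrite !coef_comp_poly_Xn // dvdn_mull // mulnK.
rewrite char_poly_comp.
have -> : 'X^2%:M - map_mx polyC (A *m A)
  = ('X%:M - map_mx polyC A) *m ((-1) *: ((- 'X)%:M - map_mx polyC A)).
  rewrite scalerBr scale_scalar_mx scaleN1r opprK mulN1r opprK.
  rewrite mulmxDr !mulmxBl map_mxM -scalar_mxM -expr2 scalar_mxC.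
  by rewrite addrA subrK.
rewrite det_mulmx detZ -!char_poly_comp comp_polyXr eqs.
(* The sign (-1)^n is spread over the n roots, one factor -1 each: (X - x) (-1) (-X - x) = X^2 -
   x^2. *)
rewrite !(rmorph_prod (comp_poly _)) -[X in _ ^+ X]szs.
elim: s {eqs szs} => [|x s IH]; first by rewrite !big_nil !mulr1.
rewrite !big_cons -IH !rmorphB /= !comp_polyX !comp_polyC rmorphXn /= exprS.
move: (\prod_(j <- s) _) (\prod_(j <- s) _) x%:P => P Q y.
move: 'X (_ ^+ size s) => X e.
ring.
Qed.

Lemma mxtrace_sqr_split (R : idomainType) (n : nat) (A : 'M[R]_n)
    (s : seq R) :
  char_poly A = \prod_(x <- s) ('X - x%:P) ->
  \tr (A *m A) = \sum_(x <- s) x ^+ 2.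
Proof.
move=> /char_poly_sqr_split eqs; rewrite -(big_map _ predT idfun).
by apply: mxtrace_split; rewrite eqs big_map.
Qed.

(** * Degree sums and extreme degrees *)

(** Double counting of ordered adjacent pairs: grouped by first entry they give the degrees, grouped
    by underlying edge they form fibres {(u, v), (v, u)} of size two. *)
Lemma sum_deg (n : nat) (G : sgraph n) :
  (\sum_v deg G v = 2 * gsize G)%N.
Proof.
transitivity (\sum_(e in [set e : 'I_n * 'I_n | adj G e.1 e.2]) 1)%N.
  rewrite (eq_bigl (fun e => adj G e.1 e.2)); last by move=> e; rewrite inE.
  rewrite -(pair_big_dep predT (fun u v => adj G u v) (fun _ _ => 1%N)) /=.
  by apply: eq_bigr => v _; rewrite sum1dep_card.
rewrite (partition_big_imset (fun e : 'I_n * 'I_n => [set e.1; e.2])) /=.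
have -> : [set [set e.1; e.2] | e in [set e | adj G e.1 e.2]] = edges G.
  by apply/setP => e; apply/imsetP/imsetP => -[x]; rewrite ?inE => xG ->;
     exists x; rewrite ?inE.
rewrite mulnC /gsize -sum_nat_const.
apply: eq_bigr => _ /imsetP[[u v] /= uv ->]; rewrite inE /= in uv.
have neq : u != v by apply: contraTneq uv => ->; rewrite adj_irr.
have neqp : (u, v) != (v, u) by rewrite xpair_eqE negb_and neq.
transitivity #|[set (u, v); (v, u)]|; last by rewrite cards2 neqp.
rewrite sum1dep_card; apply: eq_card => -[x y]; rewrite !inE !xpair_eqE /=.
apply/andP/orP => [[xy /eqP eq2]|].
  have xNy : x != y by apply: contraTneq xy => ->; rewrite adj_irr.
  have := set21 x y; have := set22 x y; rewrite eq2 !inE.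
  move: xNy => /[swap] /orP[]/eqP-> /[swap] /orP[]/eqP->;
    by rewrite ?eqxx //=; auto.
by case=> /andP[/eqP-> /eqP->]; rewrite ?uv 1?adj_sym ?uv 1?setUC ?eqxx.
Qed.

Lemma mindeg_attained (n : nat) (G : sgraph n) :
  (0 < n)%N -> exists v, deg G v = mindeg G.
Proof.
move=> n_gt0; pose v0 := Ordinal n_gt0.
have [//|min_n] : (exists v, deg G v = mindeg G) \/ mindeg G = n.
  rewrite /mindeg; elim/big_rec: _ => [|v k _ IH]; first by right.
  by rewrite /minn; case: ifP => _ //; left; exists v.
(* If the initial value n survives as the minimum, then [deg G v0] <= n = [mindeg G] <=
   [deg G v0]. *)
exists v0; apply/eqP; rewrite eqn_leq; apply/andP; split.
  by rewrite min_n -[X in (_ <= X)%N]card_ord max_card.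
rewrite /mindeg; elim: (index_enum _) (mem_index_enum v0) => // v r IH.
rewrite big_cons inE geq_min => /predU1P[->|/IH->]; last exact: orbT.
by rewrite leqnn.
Qed.

(** * Traces of [Aalpha] and bounds on squared degrees *)

Lemma mxtrace_Aalpha (R : realType) (n : nat) (alpha : R) (G : sgraph n) :
  \tr (Aalpha alpha G) = 2 * alpha * (gsize G)%:R.
Proof.
rewrite /mxtrace (eq_bigr (fun v => alpha * (deg G v)%:R)) => [|v _].
  by rewrite -mulr_sumr -natr_sum sum_deg natrM mulrCA mulrA.
by rewrite !mxE eqxx adj_irr mulr1n mulr0 addr0.
Qed.

Lemma sum_adj (R : realType) (n : nat) (G : sgraph n) (v : 'I_n) :
  \sum_w (adj G v w)%:R = (deg G v)%:R :> R.
Proof.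
rewrite -natr_sum; congr _%:R; rewrite /deg -sum1_card [RHS]big_mkcond /=.
by apply: eq_bigr => w _; rewrite inE; case: adj.
Qed.

Lemma mxtrace_Aalpha_sqr (R : realType) (n : nat) (alpha : R) (G : sgraph n) :
  \tr (Aalpha alpha G *m Aalpha alpha G)
  = alpha ^+ 2 * (\sum_v (deg G v)%:R ^+ 2)
    + (1 - alpha) ^+ 2 * (2 * (gsize G)%:R).
Proof.
(* With 2m written as the degree sum, both sides are compared vertex by vertex: row v has [deg G v]
   off-diagonal entries 1 - alpha, the others being 0. *)
rewrite -[2 in RHS]/(2%:R) -natrM -sum_deg natr_sum !mulr_sumr -big_split /=.
apply: eq_bigr => v _; rewrite mxE (bigD1 v) //= !mxE eqxx adj_irr.
rewrite mulr1n mulr0 addr0 -expr2 exprMn; congr (_ + _).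
rewrite -sum_adj mulr_sumr [RHS](bigD1 v) //= adj_irr mulr0 add0r.
apply: eq_bigr => w wv; rewrite !mxE adj_sym (negPf wv) eq_sym (negPf wv).
by rewrite mulr0 add0r; case: adj; rewrite ?mulr0 // !mulr1 expr2.
Qed.

(* de Caen's inequality. The vector b is chosen so that b_u + b_v is the
   orthogonal projection of the adjacency vector, indexed by the pairs u <> v,
   onto the vectors of that form. *)
Lemma sum_deg_sqr_le (R : realType) (n : nat) (G : sgraph n) :
  (3 <= n)%N ->
  (n%:R - 1) * (\sum_v (deg G v)%:R ^+ 2)
  <= (gsize G)%:R * (2 * (gsize G)%:R + (n%:R - 1) * (n%:R - 2)) :> R.
Proof.
move=> n_ge3; set m : R := (gsize G)%:R; set N : R := n%:R.
have N_ge3 : 3 <= N by rewrite (ler_nat _ 3).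
pose d v : R := (deg G v)%:R.
have sum_d : \sum_v d v = 2 * m by rewrite -natr_sum sum_deg natrM.
have sum_c (x : R) : \sum_(v < n) x = N * x.
  by rewrite sumr_const card_ord -[_ *+ n]mulr_natl.
pose D2 := \sum_v d v ^+ 2; rewrite -/(D2).
(* This solves the normal equations d_v = (N - 2) b_v + B with B the sum of all b_w; summing them
   over v gives B = m / (N - 1). *)
pose b v : R := (d v - m / (N - 1)) / (N - 2).
have sum_b : \sum_v b v = m / (N - 1).
  by rewrite -mulr_suml sumrB sum_d sum_c; field; lra.
have sum_b2 : \sum_v b v ^+ 2
    = (D2 - 4 * m ^+ 2 / (N - 1) + N * (m / (N - 1)) ^+ 2) / (N - 2) ^+ 2.
  rewrite (eq_bigr (fun v => (d v ^+ 2 - 2 * m / (N - 1) * d v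
                             + (m / (N - 1)) ^+ 2) / (N - 2) ^+ 2)) => [|v _].
    rewrite -mulr_suml big_split /= sumrB -mulr_sumr sum_d sum_c -/D2.
    by field; lra.
  by rewrite /b; field; lra.
have sum_db : \sum_v d v * b v = (D2 - 2 * m ^+ 2 / (N - 1)) / (N - 2).
  rewrite (eq_bigr (fun v => (d v ^+ 2 - m / (N - 1) * d v) / (N - 2)))
    => [|v _].
    by rewrite -mulr_suml sumrB -mulr_sumr sum_d -/D2; field; lra.
  by rewrite /b; field; lra.
have sum_xb : \sum_v \sum_w (adj G v w)%:R * b w = \sum_w d w * b w.
  rewrite exchange_big; apply: eq_bigr => w _ /=.
  rewrite -mulr_suml -[d w]sum_adj; congr (_ * _).
  by apply: eq_bigr => v _; rewrite adj_sym.
have sum_row v : \sum_(w | w != v) ((adj G v w)%:R - b v - b w) ^+ 2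
    = d v - 2 * (d v * b v) - 2 * (\sum_w (adj G v w)%:R * b w)
      + (N - 4) * b v ^+ 2 + 2 * (m / (N - 1)) * b v + \sum_w b w ^+ 2.
  (* The full sum has the extra term w = v, equal to (2 b_v)^2 as there are no loops. *)
  transitivity (\sum_w ((adj G v w)%:R - b v - b w) ^+ 2 - 4 * b v ^+ 2).
    by rewrite [in RHS](bigD1 v) //= adj_irr /=; ring.
  rewrite (eq_bigr (fun w => (1 - 2 * b v) * (adj G v w)%:R
    - 2 * ((adj G v w)%:R * b w) + b v ^+ 2 + 2 * b v * b w + b w ^+ 2))
    => [|w _].
    rewrite !(big_split, sumrN) /= sum_c -!mulr_sumr sum_b sum_adj -/(d v).
    by ring.
  by case: adj => /=; ring.
have : 0 <= \sum_v \sum_(w | w != v) ((adj G v w)%:R - b v - b w) ^+ 2.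
  by do 2![apply: sumr_ge0 => ? _]; apply: sqr_ge0.
rewrite (eq_bigr _ (fun v _ => sum_row v)) !(big_split, sumrN) /= -!mulr_sumr.
rewrite sum_c sum_xb sum_d sum_db sum_b sum_b2.
set Q := (X in 0 <= X).
(* The squared distance to the projection is a positive multiple of the gap between the two
   sides. *)
suff -> : Q = 2 / ((N - 1) * (N - 2))
    * (m * (2 * m + (N - 1) * (N - 2)) - (N - 1) * D2).
  rewrite pmulr_rge0 ?subr_ge0 // divr_gt0 ?ltr0n // mulr_gt0 //; lra.
by rewrite /Q; field; apply/andP; split; lra.
Qed.

(** Only one vertex of each extreme degree is kept: (a - x)^2 + (b - x)^2 exceeds (a - b)^2 / 2 by
    (a + b - 2x)^2 / 2. *)
Lemma sqr_maxdeg_mindeg_le (R : realType) (n : nat) (G : sgraph n) (x : R) :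
  (0 < n)%N ->
  ((maxdeg G)%:R - (mindeg G)%:R) ^+ 2 / 2
  <= \sum_v ((deg G v)%:R - x) ^+ 2.
Proof.
move=> n_gt0; rewrite /maxdeg.
have [|u ->] := @bigop.eq_bigmax _ (deg G); first by rewrite card_ord.
have [v <-] := mindeg_attained n G n_gt0.
have [<-|neq] := eqVneq u v.
  by rewrite subrr expr0n mul0r sumr_ge0 // => w _; apply: sqr_ge0.
rewrite (bigD1 u) //= (bigD1 v) 1?eq_sym //= addrA.
apply: ler_wpDr; first by apply: sumr_ge0 => w _; apply: sqr_ge0.
set a := _%:R; set b := _%:R; rewrite -subr_ge0.
rewrite (_ : _ - _ = (a + b - 2 * x) ^+ 2 / 2); last by field.
by rewrite divr_ge0 ?sqr_ge0.
Qed.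

(** * Inequalities for finite real sequences *)

(** Cauchy-Schwarz for the other k entries, whose sum is -x, bounds x^2 by k times the sum of their
    squares; then k x^2 is added to both sides. *)
Lemma sqr_le_of_sum0 (R : realFieldType) (s : seq R) (x : R) :
  \sum_(y <- s) y = 0 -> x \in s ->
  (size s)%:R * x ^+ 2 <= ((size s)%:R - 1) * \sum_(y <- s) y ^+ 2.
Proof.
move=> sum0 xs; have := perm_to_rem xs; set r := rem x s => sr.
move: sum0; rewrite (perm_size sr) !(perm_big _ sr) /= !big_cons => sum0.
have sum_r : \sum_(y <- r) y = - x by apply/eqP; rewrite -addr_eq0 addrC sum0.
rewrite -natr1; set k : R := (size r)%:R; set S := \sum_(y <- r) _.
have : 0 <= \sum_(y <- r) (k * y + x) ^+ 2.
  by apply: sumr_ge0 => y _; apply: sqr_ge0.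
rewrite (eq_bigr (fun y => k ^+ 2 * y ^+ 2 + 2 * k * x * y + x ^+ 2)) => [|y _];
  last by ring.
rewrite !big_split /= -!mulr_sumr sum_r big_const_seq count_predT iter_addr_0.
rewrite -[_ *+ _]mulr_natl -/k -/S => ge0.
have [k0|k0] := eqVneq k 0.
  have r0 : r = [::] by apply/size0nil/eqP; rewrite -(pnatr_eq0 R) -/k k0.
  move: sum_r; rewrite r0 big_nil => /eqP; rewrite eq_sym oppr_eq0 => /eqP->.
  by rewrite k0 /S r0 big_nil; lra.
have kp : 0 < k by rewrite lt_def k0 ler0n.
by rewrite -(ler_pM2l kp); nra.
Qed.

(* From 0 <= \sum (a - x) (N ^ 2 x - a) and AM-GM; the latter is strict
   because a ^ 2 <= \sum x ^ 2. *)
Lemma sum_sqr_lt_sqr_sum (R : realFieldType) (s : seq R) (a : R)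
    (N := (size s)%:R : R) :
  (2 <= size s)%N -> 0 < a -> a \in s ->
  (forall x, x \in s -> x <= a <= N ^+ 2 * x) ->
  4 * N ^+ 3 * \sum_(x <- s) x ^+ 2
  < ((1 + N ^+ 2) * \sum_(x <- s) x) ^+ 2.
Proof.
move=> N_ge2 a_gt0 as_ bnd.
have {}N_ge2 : 2 <= N by rewrite (ler_nat _ 2).
set S := \sum_(x <- s) x ^+ 2; set E := \sum_(x <- s) x.
have aS : a ^+ 2 <= S.
  rewrite /S (big_rem a) //= lerDl; apply: sumr_ge0 => x _; exact: sqr_ge0.
have : 0 <= \sum_(x <- s) (a - x) * (N ^+ 2 * x - a).
  rewrite big_seq; apply: sumr_ge0 => x /bnd/andP[xa ax].
  by rewrite mulr_ge0 ?subr_ge0.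
rewrite (eq_bigr (fun x => a * (N ^+ 2 + 1) * x - N ^+ 2 * x ^+ 2 - a ^+ 2))
  => [|x _]; last by ring.
rewrite !(big_split, sumrN) /= -!mulr_sumr -/S -/E.
rewrite big_const_seq count_predT iter_addr_0 -[_ *+ size s]mulr_natl -/N => le.
have NS : 0 < N ^+ 2 * S - N * a ^+ 2.
  have a2 : 0 < a ^+ 2 by rewrite exprn_gt0.
  rewrite expr2 -mulrA -mulrBr mulr_gt0 //; first by lra.
  by nra.
rewrite -(ltr_pM2l (exprn_gt0 2 a_gt0)) -exprMn.
have : (N ^+ 2 * S + N * a ^+ 2) ^+ 2 <= (a * ((1 + N ^+ 2) * E)) ^+ 2.
  have Na2 : 0 <= N * a ^+ 2 by rewrite mulr_ge0 ?sqr_ge0.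
  by rewrite ler_sqr ?nnegrE; lra.
apply: lt_le_trans; rewrite -subr_gt0.
(* AM-GM with P = N^2 S and Q = N a^2: here 4 P Q = 4 N^3 S a^2, and P > Q by [NS]. *)
rewrite (_ : _ - _ = (N ^+ 2 * S - N * a ^+ 2) ^+ 2); last by ring.
by rewrite exprn_gt0.
Qed.

(** * Spectral deviations and the energy bound *)

Theorem corollary4p4 (R : realType) (n : nat) (alpha : R) (G : sgraph n)
    (m := gsize G)
    (c := m%:R * (alpha ^+ 2 * n%:R ^+ 3
                  + n%:R ^+ 2 * (2 - 4 * alpha - alpha ^+ 2)
                  + n%:R * (4 * alpha - 2 - 2 * alpha ^+ 2 * m%:R)
                  + 4 * alpha ^+ 2 * m%:R) : R) :
  0 <= alpha -> alpha < 1 ->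
  (3 <= n)%N -> (2 <= m)%N -> gconnected G ->
  Num.sqrt c / n%:R ^+ 3 <= sdev alpha G n ->
  energy alpha G >
    2 * n%:R / (1 + n%:R ^+ 2)
    * Num.sqrt (((1 - alpha) ^+ 2 * (2 * m%:R)
                 + alpha ^+ 2 / 2 * ((maxdeg G)%:R - (mindeg G)%:R) ^+ 2)
                * n%:R).
Proof.
move=> _ alpha_lt1 n_ge3 m_ge2 _ s_n.
set N : R := n%:R; set M : R := m%:R.
have N_ge3 : 3 <= N by rewrite (ler_nat _ 3).
have M_ge2 : 2 <= M by rewrite (ler_nat _ 2).
set D := (maxdeg G)%:R - _; set T := _ + _ * D ^+ 2.
have sym := Aalpha_sym alpha G.
have split_p := prod_eigenvalues sym; have size_p := size_eigenvalues sym.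
pose t := 2 * alpha * M / N.
pose q := [seq p - t | p <- eigenvalues (Aalpha alpha G)].
pose S := \sum_(x <- q) x ^+ 2.
pose D2 : R := \sum_v (deg G v)%:R ^+ 2.
have size_q : size q = n by rewrite size_map.
have sum_c (x : R) : \sum_(p <- eigenvalues (Aalpha alpha G)) x = N * x.
  rewrite big_const_seq count_predT iter_addr_0 size_p.
  by rewrite -[_ *+ n]mulr_natl.
have sum_q : \sum_(x <- q) x = 0.
  rewrite big_map sumrB sum_c -(mxtrace_split _ _ _ _ split_p) mxtrace_Aalpha.
  by rewrite /t -/m -/M; field; lra.
have S_eq : S = alpha ^+ 2 * (D2 - 4 * M ^+ 2 / N)
              + (1 - alpha) ^+ 2 * (2 * M).
  rewrite /S big_map (eq_bigr (fun p => p ^+ 2 - 2 * t * p + t ^+ 2))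
    => [|p _]; last by ring.
  rewrite !(big_split, sumrN) /= -!mulr_sumr sum_c.
  rewrite -(mxtrace_split _ _ _ _ split_p) -(mxtrace_sqr_split _ _ _ _ split_p).
  rewrite mxtrace_Aalpha mxtrace_Aalpha_sqr -/m -/M -/D2 /t.
  by field; lra.
have T_gt0 : 0 < T.
  rewrite ltr_wpDr //; first by rewrite mulr_ge0 ?divr_ge0 ?sqr_ge0.
  by rewrite mulr_gt0 ?exprn_gt0 ?subr_gt0 //; lra.
have T_le_S : T <= S.
  (* At the mean degree 2m/n the sum of squares is D2 - 4 M^2 / N, the coefficient of alpha^2 in
     [S_eq]. *)
  have := sqr_maxdeg_mindeg_le R n G (2 * M / N) (ltnW (ltnW n_ge3)).
  rewrite -/D (eq_bigr (fun v => (deg G v)%:R ^+ 2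
    - 4 * M / N * (deg G v)%:R + (2 * M / N) ^+ 2)) => [|v _]; last first.
    by field; lra.
  rewrite !(big_split, sumrN) /= -!mulr_sumr sumr_const card_ord.
  rewrite -natr_sum sum_deg natrM -/m -/M -/D2 -[_ *+ n]mulr_natl -/N.
  rewrite (_ : _ + _ = D2 - 4 * M ^+ 2 / N); last by field; lra.
  move=> le; rewrite S_eq /T addrC lerD2r mulrAC -mulrA.
  by rewrite ler_wpM2l ?sqr_ge0.
have S_gt0 : 0 < S := lt_le_trans T_gt0 T_le_S.
have S_le_c : N * (N - 1) * S <= c.
  have := sum_deg_sqr_le R n G n_ge3; rewrite -/D2 -/m -/M -/N => caen.
  have : 0 <= N * alpha ^+ 2 * (M * (2 * M + (N - 1) * (N - 2)) - (N - 1) * D2).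
    by apply: mulr_ge0; rewrite ?subr_ge0 // mulr_ge0 ?sqr_ge0.
  (* The difference c - N (N - 1) S is exactly N alpha^2 times the gap in de Caen's inequality. *)
  rewrite -[N * (N - 1) * S <= c]subr_ge0; congr (is_true (_ <= _)).
  by rewrite S_eq /c -/M -/N; field; lra.
(* [Num.sqrt] is 0 on negative numbers, so squaring it back requires this. *)
have c_ge0 : 0 <= c.
  by apply: le_trans S_le_c; rewrite !mulr_ge0 // ?ltW //; lra.
have dev_eq : deviations alpha G = [seq `|x| | x <- q] by rewrite -map_comp.
set s := deviations alpha G in dev_eq *.
have size_s : size s = n by rewrite dev_eq size_map.
have s_le x : x \in s -> N * x <= Num.sqrt c.
  rewrite dev_eq => /mapP[y yq ->].
  have := sqr_le_of_sum0 _ _ _ sum_q yq; rewrite size_q -/N -/S => le.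
  rewrite -ler_sqr ?nnegrE ?sqrtr_ge0 ?mulr_ge0 //.
  rewrite sqr_sqrtr // exprMn real_normK ?num_real //.
  apply: le_trans S_le_c; nra.
pose r := sort >=%R s.
have r_nth i j : (i <= j < n)%N -> nth 0 r j <= nth 0 r i.
  move=> /andP[ij jn].
  apply: (sorted_leq_nth ge_trans ge_refl 0 (sort_sorted ge_total s)) => //;
    by rewrite inE size_sort size_s // (leq_ltn_trans ij).
have r_index x : x \in s -> exists2 i, (i < n)%N & x = nth 0 r i.
  rewrite -(mem_sort >=%R) => xr; exists (index x r); last by rewrite nth_index.
  by rewrite -size_s -(size_sort >=%R) index_mem.
have s_ge x : x \in s -> Num.sqrt c <= N ^+ 3 * x.
  move=> /r_index[i lt_in ->]; rewrite mulrC -ler_pdivrMr; last first.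
    by rewrite exprn_gt0 //; lra.
  (* [sdev alpha G n] is the entry of index n - 1, the last and least of the sorted list. *)
  apply: le_trans s_n _; apply: r_nth.
  by rewrite -ltnS prednK ?lt_in ?leqnn // (leq_trans _ n_ge3).
have sum_s2 : \sum_(x <- s) x ^+ 2 = S.
  by rewrite dev_eq big_map; apply: eq_bigr => x _; rewrite real_normK ?num_real.
have energy_s : energy alpha G = \sum_(x <- s) x by rewrite big_map.
pose a := nth 0 r 0.
have as_ : a \in s.
  by rewrite -(mem_sort >=%R) mem_nth // size_sort size_s (leq_trans _ n_ge3).
have a_max x : x \in s -> x <= a.
  by move=> /r_index[i lt_in ->]; apply: r_nth.
have s_ge0 x : x \in s -> 0 <= x by rewrite dev_eq => /mapP[y _ ->].
have a_gt0 : 0 < a.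
  rewrite lt_def s_ge0 // andbT; apply: contraTneq S_gt0 => a0.
  rewrite -sum_s2 big1_seq ?ltxx // => x /= xs.
  suff -> : x = 0 by rewrite expr0n.
  by apply/le_anti; rewrite -{1}a0 a_max ?s_ge0.
have bnd x : x \in s -> x <= a <= N ^+ 2 * x.
  move=> xs; rewrite a_max //=.
  (* N a <= sqrt c <= N^3 x, and N cancels. *)
  rewrite -(ler_pM2l (x := N)); last by lra.
  by apply: le_trans (s_le _ as_) _; rewrite mulrA -exprS s_ge.
have := sum_sqr_lt_sqr_sum _ s a; rewrite size_s -/N sum_s2 -energy_s.
move=> /(_ (ltnW n_ge3) a_gt0 as_ bnd) => lt.
have E_ge0 : 0 <= energy alpha G by apply: sumr_ge0.
(* After clearing 1 + N^2 and squaring, the left side is 4 N^3 T, at most 4 N^3 S. *)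
rewrite mulrAC ltr_pdivrMr; last by rewrite ltr_pwDl ?sqr_ge0.
rewrite -ltr_sqr ?nnegrE; last 2 first.
- by rewrite !mulr_ge0 ?sqrtr_ge0.
- by rewrite mulr_ge0 ?addr_ge0 ?sqr_ge0.
rewrite exprMn sqr_sqrtr ?mulr_ge0 // ?ltW // -/N [energy _ _ * _]mulrC.
apply: le_lt_trans lt.
rewrite (_ : _ * _ = 4 * N ^+ 3 * T); last by ring.
by rewrite ler_wpM2l ?mulr_ge0 ?exprn_ge0.
Qed.
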